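(* Let $u_t=\left\lfloor\frac{-1+\sqrt{8t+1}}{2}\right\rfloor$. For all integers $r\ge s>0$, $$r+\frac{5s-3}{2}+u_{r-s}\;\le\;\mathring{s}(K_{r,s})\;\le\; r+s+2\sqrt{rs}.$$
   Context: All graphs are finite and simple. The slow-coloring game on a graph $G$ is played by Lister and Painter. On each round, Lister marks a nonempty subset $M$ of the uncolored vertices, scoring $|M|$ points; Painter then colors (with a new color) a subset of $M$ that is independent in $G$. The game ends when all vertices are colored. Painter wants to minimize the total score and Lister wants to maximize it. The sum-color cost $\mathring{s}(G)$ is the total score under optimal play by both players (the score that each player can guarantee doing no worse than). $K_{r,s}$ is the complete bipartite graph with parts of sizes $r$ and $s$. *)

(* Defs.v *)
From mathcomp Require Import all_boot all_order all_algebra.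
From mathcomp Require Import reals.

Set Implicit Arguments.
Unset Strict Implicit.
Unset Printing Implicit Defensive.

Import Order.TTheory GRing.Theory Num.Theory.

Record sgraph := SGraph {
  vertex :> finType;
  adj : rel vertex;
  adj_sym : symmetric adj;
  adj_irr : irreflexive adj }.

Definition independent (G : sgraph) (I : {set G}) : bool :=
  [forall x in I, forall y in I, ~~ adj x y].

(* [U] is always the set of uncolored vertices. *)
Definition lister_move (G : sgraph) (U M : {set G}) : bool :=
  (M != set0) && (M \subset U).

(* As in the rules of the game, Painter is allowed to color no vertex. *)
Definition painter_move (G : sgraph) (M I : {set G}) : bool :=
  (I \subset M) && independent I.

(* From position [U], Painter can make the game end with at most [k] further
   points scored. When [U] is empty Lister has no move and the condition is
   vacuous; since every mark scores a point, being inductive excludes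
   infinite plays. *)
Inductive painter_ensures (G : sgraph) : {set G} -> nat -> Prop :=
  PainterEnsures (U : {set G}) (k : nat) (reply : {set G} -> {set G}) of
    (forall M, lister_move U M -> #|M| <= k) &
    (forall M, lister_move U M -> painter_move M (reply M)) &
    (forall M, lister_move U M ->
       painter_ensures (U :\: reply M) (k - #|M|)) :
  painter_ensures U k.

(* From position [U], Lister can score at least [k] further points (the
   subtraction is truncated: marking more than needed is allowed). *)
Inductive lister_ensures (G : sgraph) : {set G} -> nat -> Prop :=
| ListerDone (U : {set G}) : lister_ensures U 0
| ListerMark (U : {set G}) (k : nat) (M : {set G}) of
    lister_move U M &
    (forall I, painter_move M I -> lister_ensures (U :\: I) (k - #|M|)) :
  lister_ensures U k.

Definition is_cost (G : sgraph) (U : {set G}) (v : nat) : Prop :=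
  painter_ensures U v /\ lister_ensures U v.

Lemma painter_ensuresW (G : sgraph) (U : {set G}) k k' :
  k <= k' -> painter_ensures U k -> painter_ensures U k'.
Proof.
move=> le_kk' H; elim: H k' le_kk' => {}U {}k reply le_k ok _ IH k' le_kk'.
apply: (@PainterEnsures _ U k' reply) => // M UM.
  exact: leq_trans (le_k M UM) le_kk'.
by apply: IH => //; apply: leq_sub2r.
Qed.

Lemma lister_ensuresW (G : sgraph) (U : {set G}) k k' :
  k' <= k -> lister_ensures U k -> lister_ensures U k'.
Proof.
move=> le_k'k H; elim: H k' le_k'k => {k}{}U.
  by case=> // _; apply: ListerDone.
move=> k M UM _ IH k' le_k'k.
by apply: (ListerMark UM) => I MI; apply: IH => //; apply: leq_sub2r.
Qed.

Lemma is_cost_le (G : sgraph) (U : {set G}) k l :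
  painter_ensures U k -> lister_ensures U l -> l <= k.
Proof.
move=> H; elim: H l => {}U {}k reply le_k ok _ IH l Hl.
case: Hl le_k ok IH => // {U}V {l}l M UM H le_k ok IH.
have := IH M UM _ (H _ (ok M UM)).
by rewrite leq_subLR subnKC // le_k.
Qed.

Lemma is_cost_uniq (G : sgraph) (U : {set G}) v w :
  is_cost U v -> is_cost U w -> v = w.
Proof.
move=> [Pv Lv] [Pw Lw]; apply/eqP.
by rewrite eqn_leq (is_cost_le Pw Lv) (is_cost_le Pv Lw).
Qed.

Lemma independent1 (G : sgraph) (x : G) : independent [set x].
Proof.
by apply/'forall_implyP => y /set1P->; apply/'forall_implyP => z /set1P->;
  rewrite adj_irr.
Qed.

Lemma determinacy (G : sgraph) (U : {set G}) : {v : nat | is_cost U v}.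
Proof.
have [n] := ubnP #|U|; elim: n U => // n IH U /ltnSE leUn.
have cost (W : {set G}) : {v : nat | W \proper U -> is_cost W v}.
  have [ltWU|_] := boolP (W \proper U); last by exists 0.
  by have [v] := IH W (leq_trans (proper_card ltWU) leUn); exists v.
have [/eqP U0|] := boolP (U == set0).
  exists 0; split; last exact: ListerDone.
  have noM (M : {set G}) : lister_move U M -> False.
    by rewrite /lister_move U0 subset0 => /andP[/negP].
  by apply: (@PainterEnsures _ _ _ id) => M /noM.
case/set0Pn/sigW => x0 Ux0.
pose c (W : {set G}) := sval (cost W).
have cP (W : {set G}) : W \proper U -> is_cost W (c W) by exact: (svalP (cost W)).
pose good (M : {set G}) := [pred I : {set G} | painter_move M I && (I != set0)].
pose rep (M : {set G}) :=
  if [pick x in M] is Some x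
  then [arg min_(I < [set x] | good M I) c (U :\: I)]%N else set0.
have properD M I : lister_move U M -> good M I -> U :\: I \proper U.
  move=> /andP[_ sMU] /andP[/andP[sIM _] I0]; rewrite properE subsetDl /=.
  have [y Iy] := set0Pn _ I0; apply/subsetPn; exists y; last by rewrite inE Iy.
  exact: (subsetP sMU) (subsetP sIM _ Iy).
have repP M : lister_move U M -> good M (rep M) /\
    (forall I, good M I -> c (U :\: rep M) <= c (U :\: I)).
  move=> /andP[M0 _]; rewrite /rep; case: pickP => [x Mx|noM]; last first.
    by case/set0Pn: M0 => x; rewrite noM.
  case: arg_minnP => //=; rewrite /painter_move sub1set Mx independent1 /=.
  by apply/set0Pn; exists x; rewrite set11.
pose g (M : {set G}) := #|M| + c (U :\: rep M).
have Ux : lister_move U [set x0].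
  rewrite /lister_move sub1set Ux0 andbT.
  by apply/set0Pn; exists x0; rewrite set11.
pose M := [arg max_(M > [set x0] | lister_move U M) g M]%N.
have [UM maxM] : lister_move U M /\ forall N, lister_move U N -> g N <= g M.
  by rewrite /M; case: arg_maxnP.
exists (g M); split.
  apply: (@PainterEnsures _ _ _ rep) => N UN.
  - by apply: leq_trans (maxM N UN); rewrite leq_addr.
  - by have [/andP[]] := repP N UN.
  - have [gN _] := repP N UN; have [Pc _] := cP _ (properD _ _ UN gN).
    by apply: painter_ensuresW Pc; rewrite leq_subRL ?maxM //;
       apply: leq_trans (maxM N UN); rewrite leq_addr.
suff: forall k, k <= g M -> lister_ensures U k by apply.
elim/ltn_ind => k IHk lekg; case: (posnP k) => [->|k0].
  exact: ListerDone.
apply: (ListerMark UM) => I MI; have [->|I0] := eqVneq I set0.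
  rewrite setD0; apply: IHk; last exact: leq_trans (leq_subr _ _) lekg.
  by rewrite ltn_subrL k0 card_gt0 andbT; case/andP: UM.
have gI : good M I by apply/andP.
have [_ Lc] := cP _ (properD _ _ UM gI).
apply: lister_ensuresW Lc; rewrite leq_subLR; apply: leq_trans lekg _.
by rewrite leq_add2l; apply: (repP M UM).2.
Qed.

Definition sum_color_cost (G : sgraph) : nat := sval (determinacy [set: G]).

Lemma sum_color_costP (G : sgraph) : is_cost [set: G] (sum_color_cost G).
Proof. exact: svalP. Qed.

Definition biadj (r s : nat) : rel ('I_r + 'I_s) := fun x y =>
  match x, y with inl _, inr _ | inr _, inl _ => true | _, _ => false end.

Lemma biadj_sym (r s : nat) : symmetric (@biadj r s).
Proof. by case=> [?|?] [?|?]. Qed.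

Lemma biadj_irr (r s : nat) : irreflexive (@biadj r s).
Proof. by case. Qed.

Definition complete_bipartite (r s : nat) : sgraph := SGraph (@biadj_sym r s) (@biadj_irr r s).

Local Open Scope ring_scope.

Definition u (R : realType) (t : nat) : int :=
  Num.floor ((-1 + Num.sqrt (8 * t%:R + 1)) / 2 : R).

(* Main.v *)
Require Import Defs.
From mathcomp Require Import all_boot all_order all_algebra.
From mathcomp Require Import reals.
From mathcomp Require Import zify ring lra.

(** A position of the game on a complete bipartite graph is determined, up to
    isomorphism, by the numbers [p] and [q] of uncolored vertices in the two
    parts.  If Lister marks [a] vertices in one part and [b] in the other,
    Painter may only color marked vertices of a single part, and may as well
    color all of those, since uncoloring vertices never hurts Lister
    ([lister_ensures_mono]).  So the cost [f] satisfies
    [f(p, q) = max_(a, b) (a + b + min (f(p - a, q), f(p, q - b)))].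

    Upper bound.  The potential [phi(p, q) = (sqrt p + sqrt q)^2] satisfies
    [a + b + min (phi(p - a, q), phi(p, q - b)) <= phi(p, q)]
    ([potential_drop]): concavity of the square root shows that coloring the
    [a] vertices is good enough when [b * sqrt p <= a * sqrt q], and coloring
    the [b] vertices is good enough in the opposite case.

    Lower bound.  Let [k] be such that [k (k + 1) / 2 <= p - q]; the largest
    such [k] is [u_(p - q)].  By induction, Lister scores at least the integer
    [p + k + floor (5 q / 2) - 1], which is the claimed bound rounded up
    ([forces_lower]).  On a star he marks the center and [k] leaves, and there
    [k] may be as large as [u_p] instead of [u_(p - 1)] ([forces_star]).  With
    [q >= 2] his marks depend on [t = p - q]:
    - if [t >= 2], two vertices of the large part and one of the small part:
      there is at most one triangular number in the interval from [t - 1] to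
      [t], so [k] drops by at most one when Painter colors the two;
    - if [t = 0], one vertex in each part;
    - if [t = 1], one vertex in each part when [q] is odd or [q = 2], and two
      vertices in each part when [q >= 4] is even.
    The rounding is essential for [t = 1], and when [q = 2] so is the sharper
    bound for stars, as [u_3 > u_2]. *)

Import Order.TTheory GRing.Theory Num.Theory.

Local Open Scope nat_scope.

(** * Positions of the game on a complete bipartite graph *)

Lemma lister_ensures_mono (G : sgraph) (U V : {set G}) (k : nat) :
  U \subset V -> lister_ensures U k -> lister_ensures V k.
Proof.
move=> sUV H; elim: H V sUV => [{}U|{}U {}k M /andP[M0 sMU] _ IH] V sUV.
  exact: ListerDone.
have VM : lister_move V M by rewrite /lister_move M0 (subset_trans sMU sUV).
by apply: (ListerMark VM) => I MI; apply: IH MI _ _; apply: setSD.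
Qed.

(** The parts are indexed by a boolean so that [part b] and [part (~~ b)]
    stand for them in either order. *)
Definition part (r s : nat) (b : bool) : {set complete_bipartite r s} :=
  [set x : 'I_r + 'I_s | (if x is inl _ then true else false) == b].

Lemma setC_part (r s : nat) (b : bool) : ~: part r s b = part r s (~~ b).
Proof. by apply/setP=> x; rewrite !inE; case: (x) b => [?|?] []. Qed.

Lemma card_part (r s : nat) (b : bool) : #|part r s b| = if b then r else s.
Proof.
case: b.
  rewrite -[RHS]card_ord -(card_imset _ (@inl_inj 'I_r 'I_s)).
  apply: eq_card => -[x|x]; rewrite !inE /=.
    by rewrite imset_f.
  by apply/esym/imsetP => -[].
rewrite -[RHS]card_ord -(card_imset _ (@inr_inj 'I_r 'I_s)).
apply: eq_card => -[x|x]; rewrite !inE /=.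
  by apply/esym/imsetP => -[].
by rewrite imset_f.
Qed.

Lemma independent_part (r s : nat) (b : bool)
    (I : {set complete_bipartite r s}) : I \subset part r s b -> independent I.
Proof.
move=> /subsetP sI; apply/'forall_implyP => x /sI; rewrite inE => /eqP xb.
apply/'forall_implyP => y /sI; rewrite inE => /eqP.
by case: x y b xb {sI} => [?|?] [?|?] [].
Qed.

Lemma independent_sub_part (r s : nat) (I : {set complete_bipartite r s}) :
  independent I -> exists b, I \subset part r s b.
Proof.
move=> /'forall_implyP indI; have [->|] := eqVneq I set0.
  by exists true; rewrite sub0set.
case/set0Pn => x Ix; exists (if x is inl _ then true else false).
apply/subsetP => y Iy; rewrite inE.
have /'forall_implyP/(_ y Iy) := indI x Ix.
by case: (x) (y) => [?|?] [?|?].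
Qed.

(** Sizes are unordered, so that a lower bound proved for [p] and [q] also
    applies to the position with the roles of the parts exchanged. *)
Definition has_sizes {r s : nat} (U : {set complete_bipartite r s})
    (p q : nat) :=
  exists b, #|U :&: part r s b| = p /\ #|U :&: part r s (~~ b)| = q.

Definition forces (r s p q k : nat) :=
  forall U : {set complete_bipartite r s}, has_sizes U p q ->
  lister_ensures U k.

Lemma forces_sym (r s p q k : nat) : forces r s p q k -> forces r s q p k.
Proof. by move=> H U [b [Up Uq]]; apply: H; exists (~~ b); rewrite negbK. Qed.

Lemma forcesW (r s p q k l : nat) :
  l <= k -> forces r s p q k -> forces r s p q l.
Proof. by move=> lk H U /H; apply: lister_ensuresW. Qed.

Lemma subset_of_card (T : finType) (A : {set T}) (n : nat) :
  n <= #|A| -> exists2 B : {set T}, B \subset A & #|B| = n.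
Proof.
rewrite -bin_gt0 -cards_draws => /card_gt0P[B].
by rewrite inE => /andP[sBA /eqP cB]; exists B.
Qed.

Lemma setI_part (r s : nat) (c d : bool) (A : {set complete_bipartite r s}) :
  A \subset part r s c -> A :&: part r s d = if d == c then A else set0.
Proof.
move=> Ac; have [->|dc] := eqVneq d c; first exact/setIidPl.
have -> : d = ~~ c by case: d c dc {Ac} => [] [].
by apply/eqP; rewrite -setC_part setI_eq0 -subsets_disjoint.
Qed.

Lemma cardsD_part (r s : nat) (c d : bool)
    (U A : {set complete_bipartite r s}) :
  A \subset U :&: part r s c ->
  #|(U :\: A) :&: part r s d| =
    #|U :&: part r s d| - (if d == c then #|A| else 0).
Proof.
rewrite subsetI => /andP[AU Ac].
rewrite setIDAC cardsD setIAC (setIidPr AU) (setI_part _ _ _ _ _ Ac).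
by case: eqP; rewrite ?cards0.
Qed.

(** One round of the game seen from Lister: whatever subset of the marked
    vertices Painter colors, the outcome contains the position obtained by
    coloring all marked vertices of one part. *)
Lemma forces_mark (r s : nat) (a b p q k : nat) :
    a <= p -> b <= q -> 0 < a + b ->
    forces r s (p - a) q (k - (a + b)) -> forces r s p (q - b) (k - (a + b)) ->
  forces r s p q k.
Proof.
move=> ap bq ab0 Fa Fb U [c [Up Uq]]; rewrite -Up -Uq in ap bq.
have [A sA cA] := subset_of_card _ _ _ ap.
have [B sB cB] := subset_of_card _ _ _ bq.
have [[AU Ac] [BU Bc]] := (subsetIP sA, subsetIP sB).
have AB : [disjoint A & B].
  by rewrite (disjointWl Ac) // (disjointWr Bc) // -setC_part -setI_eq0 setICr.
have cM : #|A :|: B| = a + b.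
  by rewrite cardsU (disjoint_setI0 AB) cards0 subn0 cA cB.
have UM : lister_move U (A :|: B).
  by rewrite /lister_move -card_gt0 cM ab0 subUset AU BU.
apply: (ListerMark UM) => I /andP[IM /independent_sub_part[d Id]]; rewrite cM.
have {Id} : I \subset (A :|: B) :&: part r s d by rewrite subsetI IM Id.
rewrite setIUl (setI_part _ _ _ _ _ Ac) (setI_part _ _ _ _ _ Bc).
have [->|dc] := eqVneq d c.
  rewrite (negbTE (_ : c != ~~ c)) ?setU0; last by case: (c).
  move=> IA; apply: (lister_ensures_mono _ _ _ _ (setDS U IA)).
  apply: Fa; exists c; rewrite !(cardsD_part _ _ _ _ _ _ sA) eqxx cA Up Uq.
  by case: (c); rewrite subn0.
have -> : d = ~~ c by case: d c dc {AU Ac BU Bc sA sB Up Uq ap bq} => [] [].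
rewrite eqxx set0U => IB; apply: (lister_ensures_mono _ _ _ _ (setDS U IB)).
apply: Fb; exists c; rewrite !(cardsD_part _ _ _ _ _ _ sB) eqxx cB Up Uq.
by case: (c); rewrite subn0.
Qed.

Lemma forces_all (r s p q : nat) : forces r s p q (p + q).
Proof.
have [/eqP|pq0] := posnP (p + q).
  by rewrite addn_eq0 => /andP[/eqP-> /eqP->] U _; apply: ListerDone.
by apply: (forces_mark r s p q); rewrite // (subnn (p + q)) => U _; apply: ListerDone.
Qed.

(** * Lister's strategy *)

(** The condition [k (k + 1) <= 2 p] means [k <= u_p].  Coloring [k] leaves of
    the star preserves it with [k - 1] instead of [k]. *)
Lemma forces_star (r s : nat) (p k : nat) :
  k * k.+1 <= 2 * p -> forces r s p 1 (p + 1 + k).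
Proof.
elim: k p => [|k IH] p kp; first by rewrite addn0; apply: forces_all.
apply: (forces_mark r s k.+1 1) => //; try nia.
  by apply: (forcesW _ _ _ _ (p - k.+1 + 1 + k)); [lia | apply: IH; nia].
by apply: (forcesW _ _ _ _ (p + 0)); [lia | apply: forces_all].
Qed.

(** The value is [p + (5 q - 3) / 2 + k] rounded up to an integer.  The
    rounding adds [1/2] exactly when [q] is even, so a move from an odd to an
    even [q] gains that much; the induction needs this when [p - q = 1]. *)
Lemma forces_lower (r s : nat) (p q k : nat) :
    0 < q <= p -> k * k.+1 <= 2 * (p - q) ->
  forces r s p q (p + k + (5 * q)./2 - 1).
Proof.
have [n] := ubnP (p + q); elim: n p q k => // n IH p q k lt_n /andP[q0 qp] kpq.
have [q1|q1] := eqVneq q 1.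
  by subst q; apply: (forcesW _ _ _ _ (p + 1 + k));
    [lia | apply: forces_star; lia].
have IH' p' q' k' l :
    p' + q' < p + q -> 0 < q' <= p' -> k' * k'.+1 <= 2 * (p' - q') ->
    l <= p' + k' + (5 * q')./2 - 1 -> forces r s p' q' l.
  by move=> lt' qp' kpq' le_l; apply: forcesW le_l _; apply: IH => //; lia.
have [t2|t2] := leqP (q + 2) p.
  apply: (forces_mark r s 2 1); try lia.
    by apply: (IH' _ _ k.-1); try lia; case: k kpq => [|k] kpq /=; nia.
  by apply: (IH' _ _ k); try lia; nia.
have [t0|t0] := eqVneq p q.
  have k0 : k = 0 by nia.
  apply: (forces_mark r s 1 1); try lia.
    by apply: forces_sym; apply: (IH' _ _ 1); lia.
  by apply: (IH' _ _ 1); lia.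
have pq : p = q.+1 by lia.
have k1 : k <= 1 by nia.
subst p.
have [odd_q|even_q] := boolP (odd q).
  apply: (forces_mark r s 1 1); try lia.
    by apply: (IH' _ _ 0); lia.
  by apply: (IH' _ _ 1); lia.
have [q2|q2] := eqVneq q 2.
  subst q; apply: (forces_mark r s 1 1) => //.
    by apply: (IH' _ _ 0); lia.
  (* The general bound for [K_(3, 1)] is one less than the one for stars. *)
  by apply: (forcesW _ _ _ _ (3 + 1 + 2)); [lia | apply: forces_star].
apply: (forces_mark r s 2 2); try lia.
  by apply: forces_sym; apply: (IH' _ _ 1); lia.
by apply: (IH' _ _ 2); lia.
Qed.

(** * Painter's strategy *)

Local Open Scope ring_scope.

Section Potential.

Variable R : realType.

Definition potential (p q : nat) : R :=
  p%:R + q%:R + 2 * (Num.sqrt p%:R * Num.sqrt q%:R).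

Lemma potential_sym (p q : nat) : potential p q = potential q p.
Proof. by rewrite /potential; ring. Qed.

(** Coloring [a] vertices lowers [2 sqrt p sqrt q] by
    [2 sqrt q (sqrt p - sqrt (p - a))], which is at least [a sqrt q / sqrt p]
    since [a = (sqrt p - sqrt (p - a)) (sqrt p + sqrt (p - a))]. *)
Lemma potential_drop1 (a b p q : nat) :
    (a <= p)%N -> (0 < p)%N ->
    b%:R * Num.sqrt p%:R <= a%:R * Num.sqrt q%:R :> R ->
  (a + b)%:R + potential (p - a) q <= potential p q.
Proof.
move=> ap p0; rewrite /potential natrB // natrD.
have s0 : 0 < Num.sqrt p%:R :> R by rewrite sqrtr_gt0 ltr0n.
have t0 : 0 <= Num.sqrt q%:R :> R by apply: sqrtr_ge0.
have pa0 : 0 <= p%:R - a%:R :> R by rewrite subr_ge0 ler_nat.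
have w0 : 0 <= Num.sqrt (p%:R - a%:R) :> R by apply: sqrtr_ge0.
have ws : Num.sqrt (p%:R - a%:R) <= Num.sqrt p%:R :> R.
  by apply: ler_wsqrtr; rewrite lerBlDr lerDl ler0n.
have defw : Num.sqrt (p%:R - a%:R) ^+ 2 = p%:R - a%:R :> R by rewrite sqr_sqrtr.
have defs : Num.sqrt p%:R ^+ 2 = p%:R :> R by rewrite sqr_sqrtr ?ler0n.
move: s0 t0 w0 ws defw defs.
set x := Num.sqrt p%:R; set t := Num.sqrt q%:R.
set w := Num.sqrt (p%:R - a%:R) => s0 t0 w0 ws defw defs le_ba.
suff : b%:R <= 2 * t * (x - w) by lra.
rewrite -(ler_pM2r s0); apply: le_trans le_ba _.
have -> : a%:R = (x - w) * (x + w) :> R.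
  have -> : (x - w) * (x + w) = x ^+ 2 - w ^+ 2 by ring.
  by rewrite defw defs; ring.
rewrite -subr_ge0.
have -> : 2 * t * (x - w) * x - (x - w) * (x + w) * t
  = t * ((x - w) * (x - w)) by ring.
by rewrite !mulr_ge0 ?subr_ge0.
Qed.

Lemma potential_drop (a b p q : nat) :
    (a <= p)%N -> (b <= q)%N ->
  (a + b)%:R + potential (p - a) q <= potential p q \/
  (a + b)%:R + potential p (q - b) <= potential p q.
Proof.
move=> ap bq; have [p0|p0] := posnP p.
  right; subst p; have -> : a = 0%N by lia.
  by rewrite /potential mulr0n sqrtr0 natrB // add0n; lra.
have [q0|q0] := posnP q.
  left; subst q; have -> : b = 0%N by lia.
  by rewrite /potential mulr0n sqrtr0 natrB // addn0; lra.
have [le_ba|/ltW le_ab] := leP (b%:R * Num.sqrt p%:R) (a%:R * Num.sqrt q%:R : R).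
  by left; apply: potential_drop1.
right; rewrite addnC (potential_sym p (q - b)) (potential_sym p q).
exact: potential_drop1.
Qed.

(** Painter colors all the marked vertices of the part given by
    [potential_drop]. *)
Lemma lister_ensures_le (r s : nat) (U : {set complete_bipartite r s})
    (k : nat) :
  lister_ensures U k ->
  k%:R <= potential #|U :&: part r s true| #|U :&: part r s false|.
Proof.
elim=> {U k} [U|U k M /andP[_ MU] _ IH].
  by rewrite /potential !addr_ge0 ?mulr_ge0 ?ler0n ?sqrtr_ge0.
have play c :
    painter_move M (M :&: part r s c) /\
    M :&: part r s c \subset U :&: part r s c.
  rewrite /painter_move subsetIl (independent_part r s c) ?subsetIr //.
  by rewrite setSI.
have cM : #|M| = (#|M :&: part r s true| + #|M :&: part r s false|)%N.
  by rewrite -(cardsID (part r s true) M) setDE setC_part.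
have le c : (#|M :&: part r s c| <= #|U :&: part r s c|)%N.
  exact: subset_leq_card (play c).2.
have bound c : k%:R <= #|M|%:R +
    potential #|(U :\: (M :&: part r s c)) :&: part r s true|
              #|(U :\: (M :&: part r s c)) :&: part r s false|.
  have := IH _ (play c).1; rewrite -(lerD2l #|M|%:R) => /(le_trans _); apply.
  by rewrite -natrD ler_nat -leq_subLR.
have [drop|drop] := potential_drop _ _ _ _ (le true) (le false).
  apply: le_trans (bound true) _; rewrite cM.
  by rewrite !(cardsD_part _ _ _ _ _ _ (play true).2) subn0.
apply: le_trans (bound false) _; rewrite cM.
by rewrite !(cardsD_part _ _ _ _ _ _ (play false).2) subn0.
Qed.

(** * The real bounds *)

(** [u_t] is the nonnegative root of [k (k + 1) = 2 t], rounded down. *)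
Lemma u_triangular (t : nat) :
  exists2 k : nat, u R t = k%:Z & (k * k.+1 <= 2 * t)%N.
Proof.
have d0 : 0 <= 8 * t%:R + 1 :> R by rewrite addr_ge0 ?mulr_ge0 ?ler0n.
have d1 : 1 <= Num.sqrt (8 * t%:R + 1) :> R.
  by rewrite -{1}sqrtr1 ler_wsqrtr // lerDr mulr_ge0 ?ler0n.
have : 0 <= u R t by rewrite /u floor_ge0; lra.
have := floor_le ((-1 + Num.sqrt (8 * t%:R + 1)) / 2 : R).
rewrite -/(u R t); case: (u R t) => // k; rewrite -pmulrn => le_k _.
exists k => //; rewrite -(ler_nat R) !natrM -natr1.
have k0 : 0 <= k%:R :> R by apply: ler0n.
have : (2 * k%:R + 1) ^+ 2 <= 8 * t%:R + 1 :> R.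
  by rewrite -[leRHS](sqr_sqrtr d0) ler_sqr ?nnegrE; lra.
by nra.
Qed.

End Potential.

Theorem theorem1p12 (R : realType) (r s : nat) (hs : (0 < s)%N)
    (hrs : (s <= r)%N) :
  r%:R + (5 * s%:R - 3) / 2 + (u R (r - s)%N)%:~R
    <= (sum_color_cost (complete_bipartite r s))%:R :> R
  /\ (sum_color_cost (complete_bipartite r s))%:R
    <= r%:R + s%:R + 2 * Num.sqrt (r%:R * s%:R) :> R.
Proof.
have [painter_c lister_c] := sum_color_costP (complete_bipartite r s).
split; last first.
  have := lister_ensures_le R _ _ _ _ lister_c.
  by rewrite !setTI !card_part /potential sqrtrM ?ler0n.
have [k -> tri_k] := u_triangular R (r - s); rewrite -pmulrn.
have sizes : has_sizes [set: complete_bipartite r s] r s.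
  by exists true; rewrite !setTI !card_part.
have rs : (0 < s <= r)%N by rewrite hs hrs.
have := is_cost_le painter_c (forces_lower r s r s k rs tri_k _ sizes).
move: (sum_color_cost _) => c le_c.
have : (2 * r + 2 * k + 5 * s <= 2 * c + 3)%N by lia.
by rewrite -(ler_nat R); lra.
Qed.
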